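(* Let $p$ be a prime and $k\ge 1$ an integer. Then $n=p^k$ is neither a strong, nor a weak, nor a very weak alpha number of order $(1,1)$.
   Context: For a positive integer $n$, $\sigma(n)=\sum_{d\mid n} d$; $\omega(n)$ is the number of distinct prime divisors of $n$; $\tau(n)$ is the number of positive divisors of $n$. A positive integer $n$ is a strong alpha number of order $(1,1)$ if there exist coprime positive integers $\alpha_1,\alpha_2$ with $\sigma(n)=\frac{\alpha_1}{\alpha_2}n$ and $2\le \max(\alpha_1,\alpha_2)\le \omega(n)$; a weak alpha number of order $(1,1)$ if there exist such coprime $\alpha_1,\alpha_2$ with $\sigma(n)=\frac{\alpha_1}{\alpha_2}n$ and $2\le \omega(n)<\max(\alpha_1,\alpha_2)\le \tau(n)$; a very weak alpha number of order $(1,1)$ if there exist such coprime $\alpha_1,\alpha_2$ with $\sigma(n)=\frac{\alpha_1}{\alpha_2}n$ and $2\le \tau(n)<\max(\alpha_1,\alpha_2)<n$. *)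

(* Defs.v *)
From mathcomp Require Import all_boot all_order all_algebra.

Set Implicit Arguments.
Unset Strict Implicit.
Unset Printing Implicit Defensive.

Definition sigma (n : nat) : nat := \sum_(d <- divisors n) d.

Definition omega (n : nat) : nat := size (primes n).

Definition tau (n : nat) : nat := size (divisors n).

(* The equation sigma(n) = (a1 / a2) n is read in the rational numbers. *)
Definition sigma_ratio (n a1 a2 : nat) : Prop :=
  [/\ 0 < a1, 0 < a2, coprime a1 a2
    & ((sigma n)%:R = a1%:R / a2%:R * n%:R :> rat)%R].

Definition strong_alpha11 (n : nat) : Prop :=
  0 < n /\ exists a1 a2 : nat,
    sigma_ratio n a1 a2 /\ 2 <= maxn a1 a2 <= omega n.

Definition weak_alpha11 (n : nat) : Prop :=
  0 < n /\ exists a1 a2 : nat,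
    sigma_ratio n a1 a2 /\ [&& 2 <= omega n, omega n < maxn a1 a2 & maxn a1 a2 <= tau n].

Definition very_weak_alpha11 (n : nat) : Prop :=
  0 < n /\ exists a1 a2 : nat,
    sigma_ratio n a1 a2 /\ [&& 2 <= tau n, tau n < maxn a1 a2 & maxn a1 a2 < n].

(* Main.v *)
Require Import Defs.
From mathcomp Require Import all_boot all_order all_algebra.

(** [sigma (p ^ k)] is congruent to [1] modulo [p], so the fraction
    [sigma (p ^ k) / p ^ k] is in lowest terms.  Its reduced denominator is then
    [p ^ k] itself, which is too large for the very weak bound; the other two
    bounds fail because [omega (p ^ k) = 1]. *)

Lemma omega_pfactor (p k : nat) : prime p -> 0 < k -> omega (p ^ k) = 1.
Proof. by move=> pp k0; rewrite /omega primesX // primes_prime. Qed.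

(** Every divisor of [p ^ k] other than 1 is a multiple of [p]. *)
Lemma coprime_sigma_pfactor (p k : nat) : prime p -> coprime p (sigma (p ^ k)).
Proof.
move=> pp; have pk0 : 0 < p ^ k by rewrite expn_gt0 prime_gt0.
rewrite prime_coprime // /sigma (bigD1_seq 1) ?divisors_uniq -?dvdn_divisors //=.
rewrite dvdn_addl ?dvdn1 ?neq_ltn ?prime_gt1 ?orbT //.
rewrite big_seq_cond; apply: dvdn_sum => d.
(* Here [d] is a power of [p]; exponent 0 is excluded by [d != 1]. *)
rewrite -dvdn_divisors // => /andP[/(dvdn_pfactor _ _ pp)[[|m] _ ->]] //.
by rewrite expnS dvdn_mulr.
Qed.

Lemma sigma_ratio_cross (n a1 a2 : nat) :
  sigma_ratio n a1 a2 -> sigma n * a2 = a1 * n.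
Proof.
case=> _ a2_gt0 _ E; apply/eqP; rewrite -(Num.Theory.eqr_nat rat) !GRing.natrM E.
by rewrite GRing.mulrAC GRing.divfK // Num.Theory.pnatr_eq0 -lt0n.
Qed.

(** Gauss's lemma: [p ^ k] divides [sigma (p ^ k) * a2] and is coprime to the first factor, so it
    divides [a2]. *)
Lemma sigma_ratio_pfactor_leq (p k a1 a2 : nat) :
  prime p -> sigma_ratio (p ^ k) a1 a2 -> p ^ k <= a2.
Proof.
move=> pp H; have [_ a2_gt0 _ _] := H; apply: dvdn_leq => //.
rewrite -(@Gauss_dvdr _ (sigma (p ^ k))) ?coprimeXl ?coprime_sigma_pfactor //.
by rewrite (sigma_ratio_cross _ _ _ H) dvdn_mull.
Qed.

Theorem theorem3p2 (p k : nat) (hp : prime p) (hk : 1 <= k) :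
  [/\ ~ strong_alpha11 (p ^ k), ~ weak_alpha11 (p ^ k)
    & ~ very_weak_alpha11 (p ^ k)].
Proof.
split=> -[_ [a1 [a2 [H]]]].
- by rewrite omega_pfactor // => /andP[/leq_trans h /h].
- by rewrite omega_pfactor.
(* The bound on the maximum gives [a2 < p ^ k], against [p ^ k <= a2]. *)
case/and3P=> _ _; rewrite gtn_max => /andP[_].
by rewrite ltnNge (sigma_ratio_pfactor_leq _ _ _ _ hp H).
Qed.
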